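(* Let $K$ be a unital commutative $\mathbb{Q}$-algebra and $\alpha\ge1$. In both the commutative and the noncommutative case, for every nonzero $P\in{\mathcal N}Sym$ there exist $n\ge1$ and $F_t(z)\in\mathbb{B}_t^{[\alpha]}\langle z\rangle$ (with $z=(z_1,\dots,z_n)$) such that $\mathcal{S}_{F_t}(P)\ne0$.
   Context: $z=(z_1,\dots,z_n)$ free variables, all commutative or all noncommutative; $t$ central. $\mathbb{B}_t^{[\alpha]}\langle z\rangle$ is the set of automorphisms $F_t=z-H_t(z)$ of the polynomial algebra $K[t]\langle z\rangle$ over $K[t]$ such that $H_{t=0}(z)=0$, $H_t(z)$ is homogeneous in $z$ of some degree $d\ge\alpha$, and, after a suitable permutation of the variables, the Jacobian matrix $JH_t(z)$ is strictly lower triangular. Such $F_t$ is regarded as an automorphism of $K[[t]]\langle\langle z\rangle\rangle$. $[u\,\partial/\partial z]$ is the $K$-derivation $z_i\mapsto u_i$; $\mathcal{D}^{[\alpha]}\langle\langle z\rangle\rangle$ is the unital subalgebra of $\mathrm{End}_K(K\langle\langle z\rangle\rangle)$ generated by the derivations increasing degree by at least $\alpha-1$. ${\mathcal N}Sym$ is the free associative $K$-algebra on $\Lambda_1,\Lambda_2,\dots$; $\mathcal{S}_{F_t}:{\mathcal N}Sym\to\mathcal{D}^{[\alpha]}\langle\langle z\rangle\rangle$ is the $K$-algebra homomorphism with $\sum_{m\ge0}t^m\mathcal{S}_{F_t}(\Lambda_m)=f(t)$ ($\Lambda_0=1$), where $f(t)\in\mathcal{D}^{[\alpha]}\langle\langle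 z\rangle\rangle[[t]]$ is the unique element with $f(0)=1$ and $f(-t)u_t(z)=u_t(F_t)$ for all $u_t\in K[[t]]\langle\langle z\rangle\rangle$. *)

(* Defs.v *)
From mathcomp Require Import all_boot all_order all_fingroup all_algebra.
From mathcomp Require Import finmap.
From mathcomp Require Export monalg.

Set Implicit Arguments.
Unset Strict Implicit.
Unset Printing Implicit Defensive.

Import GRing.Theory.
Local Open Scope ring_scope.

Variant variables := Commuting | Noncommuting.

Definition mon (v : variables) (n : nat) : monomType :=
  match v with
  | Commuting => {cmonom 'I_n}
  | Noncommuting => {fmonom 'I_n}
  end.

Definition var (v : variables) (n : nat) : 'I_n -> mon v n :=
  match v with
  | Commuting => @ucm 'I_n
  | Noncommuting => @fmu 'I_n
  end.

Definition deg (v : variables) (n : nat) : mon v n -> nat :=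
  match v with
  | Commuting => @mdeg 'I_n
  | Noncommuting => @fdeg 'I_n
  end.

(* All monomials of degree at most d, each listed once: the products of the
   words of length at most d in the variables. *)
Definition monomials (v : variables) (n d : nat) : seq (mon v n) :=
  undup [seq \big[mmul/mone]_(i <- w) var v i | w : d.-bseq 'I_n].

(* R<<z>>: a power series is given by its coefficients. *)
Definition series (R : nzRingType) (v : variables) (n : nat) : Type :=
  mon v n -> R.

Definition trunc (R : nzRingType) (v : variables) (n d : nat)
    (u : series R v n) : {malg R[mon v n]} :=
  \sum_(m <- monomials v n d) << u m *g m >>.

(* Factors of a monomial of degree d have degree at most d, so the Cauchy
   product is computed on truncations. *)
Definition smul (R : nzRingType) (v : variables) (n : nat)
    (u w : series R v n) : series R v n :=
  fun m => (trunc (deg m) u * trunc (deg m) w)@_m.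

Definition order_ge (R : nzRingType) (v : variables) (n k : nat)
    (u : series R v n) : Prop :=
  forall m, (deg m < k)%N -> u m = 0.

(* K[t]<z>, with t the indeterminate of {poly K}. *)
Notation polyt K v n := {malg {poly K}[mon v n]}.

Section Operators.
Variables (K : comNzRingType) (v : variables) (n : nat).
Local Notation S := (series K v n).

Definition derivation (delta : S -> S) : Prop :=
  (forall (a : K) (u w : S),
     delta (fun m => a * u m + w m) =1 fun m => a * delta u m + delta w m) /\
  (forall u w : S,
     delta (smul u w) =1 fun m => smul (delta u) w m + smul u (delta w) m).

Definition raises_degree (e : nat) (delta : S -> S) : Prop :=
  forall (k : nat) (u : S), order_ge k u -> order_ge (k + e)%N (delta u).

Inductive Dalg (alpha : nat) : (S -> S) -> Prop :=
| Dalg_one : Dalg alpha id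
| Dalg_der delta : derivation delta -> raises_degree (alpha - 1)%N delta ->
    Dalg alpha delta
| Dalg_scale (a : K) T : Dalg alpha T -> Dalg alpha (fun u m => a * T u m)
| Dalg_add T1 T2 : Dalg alpha T1 -> Dalg alpha T2 ->
    Dalg alpha (fun u m => T1 u m + T2 u m)
| Dalg_mul T1 T2 : Dalg alpha T1 -> Dalg alpha T2 -> Dalg alpha (T1 \o T2).

Local Notation polyt := (polyt K v n).

Definition z_ (i : 'I_n) : polyt := << var v i >>.

(* An automorphism F of K[t]<z> over K[t] stands for the tuple of the F (z_ i),
   which is z - H. *)
Definition Hpart (F : {lrmorphism polyt -> polyt}) (i : 'I_n) : polyt :=
  z_ i - F (z_ i).

(* J i j = d H_i / d z_j, where d / d z_j is the K[t]-derivation sending z_j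
   to 1 and the other variables to 0. *)
Definition is_Jacobian (H : 'I_n -> polyt) (J : 'I_n -> 'I_n -> polyt) : Prop :=
  exists d : 'I_n -> {linear polyt -> polyt},
    [/\ forall j (p q : polyt), d j (p * q) = d j p * q + p * d j q,
        forall i j, d j (z_ i) = (i == j)%:R
      & forall i j, J i j = d j (H i)].

Definition strictly_lower_triangular (J : 'I_n -> 'I_n -> polyt) : Prop :=
  forall i j : 'I_n, (i <= j)%N -> J i j = 0.

Definition in_B (alpha : nat) (F : {lrmorphism polyt -> polyt}) : Prop :=
  [/\ bijective F,
      forall (i : 'I_n) (m : mon v n), ((Hpart F i)@_m).[0] = 0,
      exists2 d : nat, (alpha <= d)%N &
        forall (i : 'I_n) (m : mon v n), m \in msupp (Hpart F i) -> deg m = d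
    & exists (J : 'I_n -> 'I_n -> polyt) (s : {perm 'I_n}), is_Jacobian (Hpart F) J /\
        strictly_lower_triangular (fun i j => J (s i) (s j))].

(* u : nat -> S stands for the series sum_k t^k u_k of K[[t]]<<z>>.  When all
   F (z_ i) have zero constant term (as for F in B with alpha >= 1), the
   coefficient of t^j m in u(F) only depends on u modulo t^(j+1) and modulo
   monomials of degree larger than deg m. *)
Definition substF (F : {lrmorphism polyt -> polyt}) (u : nat -> S) : nat -> S :=
  fun j m => ((F (trunc (deg m) (fun w => \poly_(k < j.+1) u k w)))@_m)`_j.

(* f = sum_k t^k f_k in D^[alpha]<<z>>[[t]], f(0) = 1 and f(-t) u = u(F). *)
Definition is_f (alpha : nat) (F : {lrmorphism polyt -> polyt})
    (f : nat -> S -> S) : Prop :=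
  [/\ forall k, Dalg alpha (f k),
      f 0%N = id
    & forall (u : nat -> S) (j : nat) (m : mon v n),
        \sum_(k < j.+1) (-1) ^+ k * f k (u (j - k)%N) m = substF F u j m].

End Operators.

(* The free associative algebra on Lambda_1, Lambda_2, ...; the letter i of the
   alphabet nat is Lambda_(i+1). *)
Notation NSym K := {malg K[{fmonom nat}]}.

(* The algebra morphism sending Lambda_k to f_k. *)
Definition NSym_eval (K : comNzRingType) (v : variables) (n : nat)
    (f : nat -> series K v n -> series K v n) (P : NSym K) :
    series K v n -> series K v n :=
  fun u m =>
    \sum_(w <- msupp P) P@_w * foldr (fun i T => f i.+1 \o T) id (w : seq nat) u m.

(* Main.v *)
From HB Require Import structures.
Require Import Defs.
From mathcomp Require Import all_boot all_order all_fingroup all_algebra.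
From mathcomp Require Import finmap monalg.
From Stdlib Require Import FunctionalExtensionality.

Set Implicit Arguments.
Unset Strict Implicit.
Unset Printing Implicit Defensive.

Import GRing.Theory.
Local Open Scope ring_scope.

(** Let w = l_1 ... l_r be a word occurring in P and take n = r + 1 variables
    z_0, ..., z_r.  The automorphism F fixes z_0 and sends z_i to
    z_i - t^(l_i) z_(i-1) z_0^(alpha-1).  For k >= 1 the operator f_k
    sends z_i z_0^e to plus or minus z_(i-1) z_0^(e+alpha-1) if k = l_i and kills it
    otherwise, so the coefficient of z_0^(1+r(alpha-1)) in the image of z_r
    under a product of the f_k is nonzero only for the word w.

    That the f_k lie in D^[alpha]<<z>> holds for every F in B: psi =
    F^-1 (d/dt) F - d/dt is a K[t]-linear derivation, and comparing
    coefficients of t^k in (d/dt) F = F psi on K<<z>> gives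
    (k+1) F_(k+1) = sum_j F_(k-j) psi_j, where F_k and psi_k are the
    coefficients of t^k in F and psi; over Q this expresses F_(k+1) through the
    derivations psi_j. *)

(** * Monomials and their degrees, uniformly in the two cases *)

Lemma deg1 v n : deg (mone : mon v n) = 0%N.
Proof. by case: v; [apply: mdeg1 | apply: fdeg1]. Qed.

Lemma degM v n (m1 m2 : mon v n) : deg (mmul m1 m2) = (deg m1 + deg m2)%N.
Proof. by case: v m1 m2 => m1 m2; [apply: mdegM | apply: fdegM]. Qed.

Lemma deg_var v n (i : 'I_n) : deg (var v i) = 1%N.
Proof. by case: v; [apply: mdegU | apply: fdegU]. Qed.

(** Splitting off a variable on the left is possible in both cases, so most later arguments need not
    distinguish them. For commuting variables the induction is on the degree, dividing by a variable
    of nonzero exponent. *)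
Lemma mon_ind v n (P : mon v n -> Prop) :
  P mone -> (forall i m, P m -> P (mmul (var v i) m)) -> forall m, P m.
Proof.
case: v P => P P1 PM m.
  have [d le_md] := ubnP (deg m); elim: d => // d IHd in m le_md *.
  have [/mdeg_eq0I -> // | ] := eqVneq (mdeg m) 0%N.
  rewrite mdeg_eq0 => m_neq1.
  have [i mi] : exists i, m i != 0%N.
    apply/existsP; apply: contraNT m_neq1 => /existsPn m0.
    by apply/cmP => i; rewrite cm1; apply/eqP; rewrite -[_ == _]negbK m0.
  have Dm : m = mmul (ucm i) (divcm m (ucm i)).
    apply/eqP/cmP => j; rewrite cmM divcmE cmU subnKC //.
    by case: eqP => // <-; rewrite lt0n.
  rewrite Dm; apply: PM; apply: IHd.
  by move: le_md; rewrite {1}Dm degM (deg_var Commuting).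
case: m; elim=> [|i s IHs]; first by rewrite -fmoneE.
have -> : FMonom (i :: s) = mmul (fmu i) (FMonom s).
  by apply/eqP; rewrite fmP fmM fmU.
exact: PM.
Qed.

Lemma deg_prod_var v n (w : seq 'I_n) :
  deg (\big[mmul/mone]_(i <- w) var v i) = size w.
Proof.
elim: w => [|i w IHw]; first by rewrite big_nil deg1.
by rewrite big_cons degM IHw deg_var.
Qed.

Lemma mem_monomials v n d (m : mon v n) : (m \in monomials v n d) = (deg m <= d)%N.
Proof.
rewrite mem_undup; apply/imageP/idP => [[w _ ->] | le_md].
  by rewrite deg_prod_var size_bseq.
have [w Dm] : exists w, m = \big[mmul/mone]_(i <- w) var v i.
  elim/mon_ind: m {le_md} => [|i m [w ->]]; first by exists [::]; rewrite big_nil.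
  by exists (i :: w); rewrite big_cons.
by rewrite Dm deg_prod_var in le_md; exists (Bseq le_md).
Qed.

(** * Universal properties of the monomials and of their algebra *)

Section UniversalProperty.
Variables (v : variables) (n : nat) (B : nzRingType) (h : 'I_n -> B).
Hypothesis hC : v = Commuting -> commutative (@GRing.mul B).

Lemma prodrM_commutative (s : seq 'I_n) (f g : 'I_n -> B) :
  commutative (@GRing.mul B) ->
  \prod_(i <- s) (f i * g i) = \prod_(i <- s) f i * \prod_(i <- s) g i.
Proof.
move=> mulC; elim: s => [|i s IHs]; first by rewrite !big_nil mulr1.
by rewrite !big_cons IHs -!mulrA; congr (_ * _); rewrite !mulrA (mulC (g i)).
Qed.

Lemma mon_morphism :
  {phi : {mmorphism mon v n -> B} | forall i, phi (var v i) = h i}.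
Proof.
case: v hC => [/(_ erefl) mulC|_].
  pose phi (m : {cmonom 'I_n}) := \prod_i h i ^+ m i.
  have phiM : mmorphism phi.
    split=> [m1 m2|]; last by apply: big1 => i _; rewrite cm1.
    rewrite -prodrM_commutative //; apply: eq_bigr => i _.
    by rewrite cmM exprD.
  pose phi' : {mmorphism _ -> _} := HB.pack phi (isMultiplicative.Build _ _ _ phiM).
  exists phi' => i; rewrite /= /phi -[RHS](big_pred1_eq *%R) [RHS]big_mkcond.
  by apply: eq_bigr => j _; rewrite cmU eq_sym; case: eqP.
pose phi (m : {fmonom 'I_n}) := \prod_(i <- (m : seq _)) h i.
have phiM : mmorphism phi.
  by split=> [m1 m2|]; rewrite /phi ?fmM ?big_cat // fm1 big_nil.
pose phi' : {mmorphism _ -> _} := HB.pack phi (isMultiplicative.Build _ _ _ phiM).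
by exists phi' => i; rewrite /= /phi fmU big_seq1.
Qed.

Lemma malg_morphism (R : nzRingType) (c : {rmorphism R -> B}) :
  (forall a x, GRing.comm (c a) x) ->
  {phi : {rmorphism {malg R[mon v n]} -> B} |
    (forall a p, phi (a *: p) = c a * phi p) /\
    (forall i, phi << var v i >> = h i)}.
Proof.
move=> cC; have [phi Dphi] := mon_morphism.
have mM : multiplicative (mmap c phi).
  by apply: commr_mmap_is_multiplicative => *; apply: cC.
pose phi' : {rmorphism _ -> _} :=
  HB.pack (mmap c phi) (GRing.isMultiplicative.Build _ _ _ mM).
exists phi'; split=> [a p|i]; first exact: mmapZ.
have -> : phi' << var v i >> = c 1 * phi (var v i) by exact: mmapU.
by rewrite Dphi rmorph1 mul1r.
Qed.

End UniversalProperty.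

(** * Endomorphisms, derivations and the order filtration of the polynomial algebra *)

Section FreeAlgebra.
Variables (v : variables) (n : nat) (R : comNzRingType).
Local Notation A := {malg R[mon v n]}.
Implicit Types (p q : A) (m : mon v n).

Lemma malg_mulC : v = Commuting -> commutative (@GRing.mul A).
Proof. by move=> v_comm; subst v => p q; apply: fgmulC. Qed.

Lemma malgMU m1 m2 : << m1 >> * << m2 >> = << mmul m1 m2 >> :> A.
Proof. by rewrite malgM_def fgmulUU mul1r. Qed.

Lemma malgUZ (c : R) m : << c *g m >> = c *: << m >> :> A.
Proof. by apply/malgP => m'; rewrite mcoeffZ !mcoeffU mulrnAr mulr1. Qed.

Lemma malg_linear_ext (V : lmodType R) (f g : {linear A -> V}) :
  (forall m, f << m >> = g << m >>) -> f =1 g.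
Proof.
move=> eq_fg p; rewrite [p]monalgE !linear_sum; apply: eq_bigr => m _.
by rewrite malgUZ !linearZ /= eq_fg.
Qed.

Lemma malgC_comm (a : R) p : GRing.comm a%:MP p.
Proof.
rewrite /GRing.comm mul_malgC [p]monalgE linear_sum mulr_suml.
apply: eq_bigr => m _.
rewrite malgM_def fgmulUU mulm1.
by apply/malgP => m'; rewrite mcoeffZ !mcoeffU mulrnAr mulrC.
Qed.

Lemma malg_endomorphism (h : 'I_n -> A) :
  {F : {lrmorphism A -> A} | forall i, F << var v i >> = h i}.
Proof.
have [|phi [phiZ phiU]] := malg_morphism h malg_mulC (c := malgC).
  exact: malgC_comm.
have phiZ' : scalable phi by move=> a p; rewrite phiZ mul_malgC.
pose F : {lrmorphism _ -> _} :=
  HB.pack (phi : A -> A) (GRing.RMorphism.class phi)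
    (GRing.isScalable.Build _ _ _ _ _ phiZ').
by exists F.
Qed.

Lemma malg_endomorphism_id (F : {lrmorphism A -> A}) :
  (forall i, F << var v i >> = << var v i >>) -> F =1 id.
Proof.
move=> Fvar; apply: (malg_linear_ext (g := idfun)).
elim/mon_ind => [|i m IHm]; first exact: rmorph1.
by rewrite -malgMU rmorphM /= Fvar IHm.
Qed.

(* [d p] is the coefficient of ['X] in the image of [p] under the morphism
   to [{poly A}] sending [z_i] to [z_i + (e i) 'X]. *)
Lemma malg_derivation (e : 'I_n -> A) : {d : {linear A -> A} |
  (forall p q, d (p * q) = d p * q + p * d q) /\
  (forall i, d << var v i >> = e i)}.
Proof.
pose h i : {poly A} := << var v i >>%:P + (e i)%:P * 'X.
have hC : v = Commuting -> commutative (@GRing.mul {poly A}).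
  move=> v_comm p q; apply/polyP => k; rewrite coefM coefMr.
  by apply: eq_bigr => j _; apply: malg_mulC.
have cC (a : R) (p : {poly A}) : GRing.comm ((polyC \o malgC) a) p.
  by apply/polyP => k; rewrite coefCM coefMC; apply: malgC_comm.
have [phi [phiZ phiU]] := malg_morphism h hC cC.
have phi_linear k : linear (fun p => (phi p)`_k).
  by move=> a p q; rewrite rmorphD phiZ coefD coefCM mul_malgC.
pose phi_ k : {linear A -> A} :=
  HB.pack (fun p => (phi p)`_k) (GRing.isLinear.Build _ _ _ _ _ (phi_linear k)).
(* Since the constant coefficient of [phi] is the identity, the coefficient of ['X] in
   [phi p * phi q] is the product rule. *)
have phi0 p : (phi p)`_0 = p.
  apply: (malg_linear_ext (f := phi_ 0%N) (g := idfun)) => m /=.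
  elim/mon_ind: m => [|i m IHm]; first by rewrite rmorph1 coef1.
  by rewrite -malgMU rmorphM coef0M IHm phiU coefD coefC coefMX addr0.
exists (phi_ 1%N); split=> [p q|i] /=.
  by rewrite rmorphM coefM !big_ord_recl big_ord0 addr0 /= !phi0 addrC.
by rewrite phiU coefD coefC coefMX coefC add0r.
Qed.

(** Agreement of two polynomials up to degree [d] becomes [mord d.+1] of their difference; this
    filtration stands in for the topology of power series. *)
Definition mord (k : nat) p := order_ge k (fun m => p@_m).

Lemma mord0 p : mord 0 p. Proof. by []. Qed.

Lemma mord_le k l p : (k <= l)%N -> mord l p -> mord k p.
Proof. by move=> le_kl p_l m lt_mk; apply/p_l/(leq_trans lt_mk). Qed.

Lemma mordB k p q : mord k p -> mord k q -> mord k (p - q).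
Proof. by move=> pk qk m lt_mk; rewrite mcoeffB pk ?qk ?subrr. Qed.

Lemma mordD k p q : mord k p -> mord k q -> mord k (p + q).
Proof. by move=> pk qk m lt_mk; rewrite mcoeffD pk ?qk ?addr0. Qed.

Lemma mordM k l p q : mord k p -> mord l q -> mord (k + l) (p * q).
Proof.
move=> pk ql m lt_m; rewrite mcoeffMl big1 // => m1 _; rewrite big1 // => m2 _.
case: eqP => // Dm; have [/pk -> | le_k] := ltnP (deg m1) k; first by rewrite mul0r.
have [/ql -> | le_l] := ltnP (deg m2) l; first by rewrite mulr0.
by move: lt_m; rewrite -Dm degM ltnNge leq_add.
Qed.

Lemma mordU m : mord (deg m) << m >>.
Proof. by move=> m' lt_m'; rewrite mcoeffU1; case: eqP lt_m' => // ->; rewrite ltnn. Qed.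

Lemma mord_var i : mord 1 << var v i >>.
Proof. by rewrite -(deg_var v i); apply: mordU. Qed.

Definition raises (e : nat) (T : {linear A -> A}) :=
  forall m, mord (deg m + e) (T << m >>).

Lemma raises_mord e (T : {linear A -> A}) k p :
  raises e T -> mord k p -> mord (k + e) (T p).
Proof.
move=> Te pk m lt_m; rewrite [p]monalgE linear_sum raddf_sum big1_seq // => m' _.
rewrite malgUZ linearZ /= mcoeffZ.
have [/pk -> | le_k] := ltnP (deg m') k; first by rewrite mul0r.
by rewrite Te ?mulr0 // (leq_trans lt_m) ?leq_add2r.
Qed.

(** Induction on monomials through [F (x m) - x m = (F x - x) F m + x (F m - m)]. The hypothesis has
    [e.+1] because a variable itself has degree 1. *)
Lemma raises_endomorphism_sub e (F : {lrmorphism A -> A}) :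
  (forall i, mord e.+1 (F << var v i >> - << var v i >>)) ->
  raises 0 F /\ forall m, mord (deg m + e) (F << m >> - << m >>).
Proof.
move=> Fvar; have F0 : raises 0 F.
  elim/mon_ind => [|i m IHm]; first by rewrite deg1.
  have F1 : mord 1 (F << var v i >>).
    rewrite -(subrK << var v i >> (F << var v i >>)); apply: mordD.
      exact: mord_le (Fvar i).
    exact: mord_var.
  by rewrite -malgMU rmorphM degM -addnA deg_var; apply: mordM IHm.
split=> //; elim/mon_ind => [|i m IHm].
  by rewrite rmorph1 subrr => m' _; rewrite mcoeff0.
have -> : F << mmul (var v i) m >> - << mmul (var v i) m >> =
    (F << var v i >> - << var v i >>) * F << m >> +
    << var v i >> * (F << m >> - << m >>).
  by rewrite -malgMU rmorphM mulrBl mulrBr addrA subrK.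
rewrite degM; apply: mordD.
  by rewrite addnAC deg_var -[deg m]addn0; apply: mordM (F0 m); apply: Fvar.
by rewrite -addnA; apply: mordM IHm; apply: mordU.
Qed.

Lemma trunc_coef d (u : series R v n) m :
  (trunc d u)@_m = if (deg m <= d)%N then u m else 0.
Proof.
rewrite /trunc raddf_sum /= -mem_monomials; case: ifP => [m_d | m_d].
  rewrite (bigD1_seq m) ?undup_uniq //= mcoeffUU big1 ?addr0 // => m' /negbTE.
  by rewrite mcoeffU => ->.
by rewrite big1_seq // => m' /andP[_ m'_d]; rewrite mcoeffU; case: eqP m_d => // <- /idP.
Qed.

(** In [p q - p' q' = (p - p') q + p' (q - q')] both terms have order above [d]. *)
Lemma mcoeffM_congr d p p' q q' m :
  mord d.+1 (p - p') -> mord d.+1 (q - q') -> (deg m <= d)%N ->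
  (p * q)@_m = (p' * q')@_m.
Proof.
move=> pp' qq' le_md; apply/eqP; rewrite -subr_eq0 -mcoeffB.
have -> : p * q - p' * q' = (p - p') * q + p' * (q - q').
  by rewrite mulrBl mulrBr addrA subrK.
by rewrite mcoeffD (mordM pp' (mord0 q)) ?(mordM (mord0 p') qq') ?addn0 ?addr0.
Qed.

(** The truncation in [smul] varies with the coefficient that is read; a common bound allows
    comparison with a single product of polynomials. *)
Lemma smul_trunc d (u w : series R v n) m : (deg m <= d)%N ->
  smul u w m = (trunc d u * trunc d w)@_m.
Proof.
move=> le_md.
by apply: (@mcoeffM_congr (deg m)) => // m' lt_m';
  rewrite mcoeffB !trunc_coef -ltnS lt_m' (leq_trans _ le_md) ?subrr.
Qed.

Lemma smulE d (u w : series R v n) m : (deg m <= d)%N ->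
  smul u w m = \sum_(m1 <- monomials v n d) \sum_(m2 <- monomials v n d)
    u m1 * w m2 *+ (mmul m1 m2 == m).
Proof.
move=> le_md; rewrite (smul_trunc _ _ le_md) mulr_suml raddf_sum.
apply: eq_bigr => m1 _; rewrite mulr_sumr raddf_sum; apply: eq_bigr => m2 _.
by rewrite malgM_def fgmulUU /= mcoeffU.
Qed.

End FreeAlgebra.

(** * Operators on power series arising as coefficients of powers of [t] *)

Section CoefficientOperators.
Variables (K : comNzRingType) (v : variables) (n : nat).
Local Notation A := (polyt K v n).
Local Notation S := (series K v n).
Implicit Types (T : {linear A -> A}) (p q : A) (Q : series {poly K} v n) (a b : S).

(* The coefficient of [t^k] of the extension of [T] to K[[t]]<<z>>, restricted
   to K<<z>>. *)
Definition tcoef T (k : nat) a : S :=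
  fun m => (T (trunc (deg m) (fun w => (a w)%:P)))@_m`_k.

Lemma mcoeff_linear_trunc T d Q m :
  (T (trunc d Q))@_m = \sum_(w <- monomials v n d) Q w * (T << w >>)@_m.
Proof.
rewrite /trunc !linear_sum; apply: eq_bigr => w _.
by rewrite malgUZ linearZ /= mcoeffZ.
Qed.

(** Continuity: an operator that does not lower the order cannot carry terms of degree above [d]
    into degree at most [d]. *)
Lemma mcoeff_raises_congr T d p q m :
  raises 0 T -> mord d.+1 (p - q) -> (deg m <= d)%N -> (T p)@_m = (T q)@_m.
Proof.
move=> T0 pq le_md; apply/eqP; rewrite -subr_eq0 -mcoeffB -linearB.
by rewrite (raises_mord T0 pq) // addn0.
Qed.

Lemma mord_sub_trunc d p Q :
  (forall m, (deg m <= d)%N -> p@_m = Q m) -> mord d.+1 (p - trunc d Q).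
Proof. by move=> pQ m lt_m; rewrite mcoeffB trunc_coef -ltnS lt_m pQ ?subrr. Qed.

Lemma tcoef_sum T k a m : tcoef T k a m =
  \sum_(w <- monomials v n (deg m)) a w * (T << w >>)@_m`_k.
Proof.
rewrite /tcoef mcoeff_linear_trunc coef_sum.
by apply: eq_bigr => w _; rewrite coefCM.
Qed.

Lemma tcoef0 T : (forall m m', (T << m >>)@_m'`_0 = (m == m')%:R) -> tcoef T 0 = id.
Proof.
move=> T0; apply: functional_extensionality => a.
apply: functional_extensionality => m.
rewrite tcoef_sum (bigD1_seq m) ?undup_uniq ?mem_monomials //= T0 eqxx mulr1.
by rewrite big1 ?addr0 // => w /negbTE w_m; rewrite T0 w_m mulr0.
Qed.

(** The truncation in [tcoef] loses [m] when [deg m' < deg m], but then the right side vanishes too,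
    since [T] does not lower the order. *)
Lemma tcoefU T k m m' : raises 0 T ->
  tcoef T k (fun w => (m == w)%:R) m' = (T << m >>)@_m'`_k.
Proof.
move=> T0; rewrite tcoef_sum.
have [le_m | lt_m'] := leqP (deg m) (deg m'); last first.
  rewrite T0 ?addn0 // coef0 big1_seq // => w /andP[_].
  by rewrite mem_monomials; case: eqP => [<-|_ _]; rewrite ?mul0r // leqNgt lt_m'.
rewrite (bigD1_seq m) ?undup_uniq ?mem_monomials //= eqxx mul1r.
by rewrite big1 ?addr0 // => w; rewrite eq_sym => /negbTE ->; rewrite mul0r.
Qed.

(** The multiples of [t] form an ideal, so congruence to the identity modulo [t] passes from the
    variables to all monomials. *)
Lemma endomorphism_coef0 (F : {lrmorphism A -> A}) :
  (forall i m, (F << var v i >>)@_m`_0 = (var v i == m)%:R) ->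
  forall m m', (F << m >>)@_m'`_0 = (m == m')%:R.
Proof.
move=> Fvar; pose tdiv p := forall m, p@_m`_0 = 0.
have tdivM p q : tdiv p \/ tdiv q -> tdiv (p * q).
  move=> pq m; rewrite mcoeffMl coef_sum big1 // => m1 _.
  rewrite coef_sum big1 // => m2 _; rewrite coefMn coef0M.
  by case: pq => ->; rewrite ?mul0r ?mulr0 mul0rn.
have tdivD p q : tdiv p -> tdiv q -> tdiv (p + q).
  by move=> p0 q0 m; rewrite mcoeffD coefD p0 q0 addr0.
suff tdivF m : tdiv (F << m >> - << m >>).
  move=> m m'; have /eqP := tdivF m m'.
  by rewrite mcoeffB coefB subr_eq0 mcoeffU1 -polyC_natr coefC => /eqP.
elim/mon_ind: m => [|i m IHm]; first by move=> m'; rewrite rmorph1 subrr mcoeff0 coef0.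
have -> : F << mmul (var v i) m >> - << mmul (var v i) m >> =
    (F << var v i >> - << var v i >>) * F << m >> +
    << var v i >> * (F << m >> - << m >>).
  by rewrite -malgMU rmorphM mulrBl mulrBr addrA subrK.
have tdiv_var : tdiv (F << var v i >> - << var v i >>).
  by move=> m1; rewrite mcoeffB coefB Fvar mcoeffU1 -polyC_natr coefC subrr.
by apply: tdivD; apply: tdivM; [left | right].
Qed.

Lemma tcoef_linear T k (c : K) a b m :
  tcoef T k (fun m => c * a m + b m) m = c * tcoef T k a m + tcoef T k b m.
Proof.
rewrite !tcoef_sum mulr_sumr -big_split.
by apply: eq_bigr => w _; rewrite mulrDl mulrA.
Qed.

Lemma tcoef_conv T d Q m k :
  (T (trunc d Q))@_m`_k =
  \sum_(j < k.+1) (T (trunc d (fun w => ((Q w)`_j)%:P)))@_m`_(k - j).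
Proof.
transitivity (\sum_(j < k.+1) \sum_(w <- monomials v n d)
    (Q w)`_j * (T << w >>)@_m`_(k - j)).
  rewrite mcoeff_linear_trunc coef_sum exchange_big.
  by apply: eq_bigr => w _; rewrite coefM.
apply: eq_bigr => j _; rewrite mcoeff_linear_trunc coef_sum.
by apply: eq_bigr => w _; rewrite coefCM.
Qed.

(** The polynomial [p] and the truncation of the series [T2 a] differ only above degree [deg m], and
    [T1] does not bring the difference down. What remains is a Cauchy product in [t]. *)
Lemma tcoef_comp T1 T2 k a m : raises 0 T1 -> raises 0 T2 ->
  (T1 (T2 (trunc (deg m) (fun w => (a w)%:P))))@_m`_k =
  \sum_(j < k.+1) tcoef T1 (k - j) (tcoef T2 j a) m.
Proof.
move=> T10 T20; set p := T2 _.
rewrite (mcoeff_raises_congr (d := deg m)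
  (q := trunc (deg m) (fun w => (T2 (trunc (deg w) (fun w => (a w)%:P)))@_w))) //.
  by rewrite tcoef_conv.
apply: mord_sub_trunc => w le_w; apply: (mcoeff_raises_congr (d := deg w)) => //.
by apply: mord_sub_trunc => w' le_w'; rewrite trunc_coef (leq_trans le_w').
Qed.

Lemma tcoef_raises_degree T e k : raises e T -> raises_degree e (tcoef T k).
Proof.
move=> Te l a al m lt_m; rewrite tcoef_sum big1 // => w _.
have [/al -> | le_l] := ltnP (deg w) l; first by rewrite mul0r.
by rewrite Te ?coef0 ?mulr0 // (leq_trans lt_m) ?leq_add2r.
Qed.

Lemma smul_coef Q a k m :
  (smul Q (fun w => (a w)%:P) m)`_k = smul (fun w => (Q w)`_k) a m.
Proof.
rewrite !(@smulE _ _ _ (deg m)) // coef_sum; apply: eq_bigr => m1 _.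
by rewrite coef_sum; apply: eq_bigr => m2 _; rewrite coefMn coefMC.
Qed.

Lemma smul_coefl Q a k m :
  (smul (fun w => (a w)%:P) Q m)`_k = smul a (fun w => (Q w)`_k) m.
Proof.
rewrite !(@smulE _ _ _ (deg m)) // coef_sum; apply: eq_bigr => m1 _.
by rewrite coef_sum; apply: eq_bigr => m2 _; rewrite coefMn coefCM.
Qed.

Lemma smul_polyC a b m :
  smul (fun w => (a w)%:P) (fun w => (b w)%:P) m = (smul a b m)%:P.
Proof.
rewrite !(@smulE _ _ _ (deg m)) // rmorph_sum; apply: eq_bigr => m1 _.
by rewrite rmorph_sum; apply: eq_bigr => m2 _; rewrite rmorphMn rmorphM.
Qed.

(** The product rule is transferred from polynomials: by [El], [Er] and [Em], passing between
    products of series and products of truncations changes nothing at [m]. *)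
Lemma tcoef_derivation T k : raises 0 T ->
  (forall p q, T (p * q) = T p * q + p * T q) -> derivation (tcoef T k).
Proof.
move=> T0 TM; split=> [c a b m | a b m]; first exact: tcoef_linear.
pose C (c : S) : series {poly K} v n := fun w => (c w)%:P.
pose Q (c : S) : series {poly K} v n := fun w => (T (trunc (deg w) (C c)))@_w.
have TQ c : mord (deg m).+1 (T (trunc (deg m) (C c)) - trunc (deg m) (Q c)).
  apply: mord_sub_trunc => w le_w; apply: (mcoeff_raises_congr (d := deg w)) => //.
  by apply: mord_sub_trunc => w' le_w'; rewrite trunc_coef (leq_trans le_w').
have sub0 p : mord (deg m).+1 (p - p) by rewrite subrr => w _; rewrite mcoeff0.
have El : (T (trunc (deg m) (C a)) * trunc (deg m) (C b))@_m = smul (Q a) (C b) m.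
  by rewrite /smul; apply: mcoeffM_congr (TQ a) (sub0 _) _.
have Er : (trunc (deg m) (C a) * T (trunc (deg m) (C b)))@_m = smul (C a) (Q b) m.
  by rewrite /smul; apply: mcoeffM_congr (sub0 _) (TQ b) _.
have Em : (T (trunc (deg m) (C (smul a b))))@_m =
    (T (trunc (deg m) (C a) * trunc (deg m) (C b)))@_m.
  apply: (mcoeff_raises_congr T0 _ (leqnn _)) => w lt_w.
  rewrite mcoeffB trunc_coef -ltnS lt_w /C -smul_polyC.
  by rewrite (@smul_trunc _ _ _ (deg m)) ?subrr.
rewrite /tcoef -/(C _) Em TM mcoeffD coefD El Er.
congr (_ + _); [exact: smul_coef | exact: smul_coefl].
Qed.

Lemma substF_tcoef (F : {lrmorphism A -> A}) (u : nat -> S) j m :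
  substF F u j m = \sum_(k < j.+1) tcoef F k (u (j - k)%N) m.
Proof.
pose Q w : {poly K} := \poly_(k < j.+1) u k w.
have Qk (k : 'I_j.+1) : (fun w => ((Q w)`_k)%:P) = (fun w => (u k w)%:P).
  by apply: functional_extensionality => w; rewrite coef_poly ltn_ord.
apply: etrans (tcoef_conv F (deg m) Q m j) _.
(* [tcoef_conv] sums over the power of [t] taken from [u], the claim over the power taken from [F];
   hence the reversal. *)
rewrite [RHS](reindex_inj rev_ord_inj); apply: eq_bigr => k _; rewrite Qk.
have -> : rev_ord k = (j - k)%N :> nat by apply: subSS.
by rewrite subKn // -ltnS ltn_ord.
Qed.

(** The derivation [d/dt], a plain function because it is not linear over K[t]. *)
Definition malg_deriv p : A := [malg m in msupp p => (p@_m)^`()].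

Lemma malg_derivE p m : (malg_deriv p)@_m = (p@_m)^`().
Proof. by rewrite mcoeffE; case: ifPn => // /mcoeff_outdom ->; rewrite deriv0. Qed.

Lemma malg_derivD p q : malg_deriv (p + q) = malg_deriv p + malg_deriv q.
Proof. by apply/malgP => m; rewrite mcoeffD !malg_derivE mcoeffD derivD. Qed.

Lemma malg_derivZ c p : malg_deriv (c *: p) = c^`() *: p + c *: malg_deriv p.
Proof. by apply/malgP => m; rewrite mcoeffD !mcoeffZ !malg_derivE mcoeffZ derivM. Qed.

Lemma malg_derivM p q :
  malg_deriv (p * q) = malg_deriv p * q + p * malg_deriv q.
Proof.
(* Differentiation can shrink the support, so all the products are expanded over the supports of [p]
   and [q]. *)
have supp r : (msupp (malg_deriv r) `<=` msupp r)%fset.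
  apply/fsubsetP => m; rewrite -!mcoeff_neq0 malg_derivE.
  by apply: contraNneq => ->; rewrite deriv0.
apply/malgP => m; rewrite mcoeffD malg_derivE mcoeffMl.
rewrite (mcoeffMlw _ (supp p) (fsubset_refl _)) (mcoeffMlw _ (fsubset_refl _) (supp q)).
rewrite -big_split raddf_sum; apply: eq_bigr => m1 _.
rewrite -big_split raddf_sum; apply: eq_bigr => m2 _ /=.
by rewrite derivMn derivM !malg_derivE mulrnDl.
Qed.

Lemma mord_deriv k p : mord k p -> mord k (malg_deriv p).
Proof. by move=> pk m /pk p0; rewrite malg_derivE p0 deriv0. Qed.

Lemma malg_deriv_trunc d a : malg_deriv (trunc d (fun w => (a w)%:P)) = 0.
Proof.
apply/malgP => m; rewrite malg_derivE mcoeff0 trunc_coef.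
by case: ifP => _; rewrite ?derivC ?deriv0.
Qed.

Lemma malg_derivU m : malg_deriv << m >> = 0.
Proof.
apply/malgP => m'; rewrite malg_derivE mcoeff0 mcoeffU1.
by rewrite -polyC_natr derivC.
Qed.

(* [psi = F^-1 (d/dt) F - d/dt] is a difference of two derivations that both
   send [t] to 1. *)
Lemma logarithmic_derivative e (F G : {lrmorphism A -> A}) :
    cancel F G -> cancel G F -> raises 0 G ->
    (forall m, mord (deg m + e) (F << m >> - << m >>)) ->
  exists psi : {linear A -> A},
    [/\ forall p q, psi (p * q) = psi p * q + p * psi q, raises e psi &
        forall p, F (psi p) = malg_deriv (F p) - F (malg_deriv p)].
Proof.
move=> FK GK G0 Fe.
pose psi0 p := G (malg_deriv (F p)) - malg_deriv p.
have GZ c p : G (c *: p) = c *: G p by rewrite linearZ.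
have GD p q : G (p + q) = G p + G q by rewrite rmorphD.
(* Neither term of [psi0] is linear over K[t], but both produce the same extra term, the derivative
   of [c] times [p], because [G] undoes [F]. *)
have psi_linear : linear psi0.
  move=> c p q; rewrite /psi0 linearP !malg_derivD !malg_derivZ !GD !GZ FK.
  rewrite scalerBr opprD addrACA; congr (_ + _).
  by rewrite opprD addrACA subrr add0r.
pose psi : {linear A -> A} :=
  HB.pack psi0 (GRing.isLinear.Build _ _ _ _ _ psi_linear).
exists psi; split=> [p q | m | p] /=; rewrite /psi0.
- rewrite rmorphM !malg_derivM rmorphD !rmorphM /= !FK opprD addrACA.
  by rewrite mulrBl mulrBr.
(* As [<< m >>] is constant in [t], it may be subtracted before differentiating, which makes the
   bound [Fe] applicable. *)
- have -> : malg_deriv (F << m >>) = malg_deriv (F << m >> - << m >>).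
    by apply/malgP => m'; rewrite malg_derivE [RHS]malg_derivE mcoeffB derivB
       -(malg_derivE << m >>) malg_derivU mcoeff0 subr0.
  by rewrite malg_derivU subr0 -[(_ + e)%N]addn0; apply/(raises_mord G0)/mord_deriv/Fe.
- by rewrite rmorphB /= GK.
Qed.

End CoefficientOperators.

(** * The coefficients of an automorphism lie in [Dalg] *)

Section OperatorAlgebra.
Variables (K : comAlgType rat) (v : variables) (n : nat).
Local Notation A := (polyt K v n).
Local Notation S := (series K v n).

Lemma Dalg0 alpha : @Dalg K v n alpha (fun u m => 0).
Proof.
have -> : (fun (u : S) m => 0) = (fun u m => 0 * u m).
  by do 2!apply: functional_extensionality => ?; rewrite mul0r.
by apply: Dalg_scale; apply: Dalg_one.
Qed.

Lemma Dalg_sum alpha d (T : 'I_d -> S -> S) :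
  (forall j, Dalg alpha (T j)) -> Dalg alpha (fun u m => \sum_(j < d) T j u m).
Proof.
elim: d => [|d IHd] in T * => DT.
  have -> : (fun (u : S) m => \sum_(j < 0) T j u m) = (fun u m => 0).
    by do 2!apply: functional_extensionality => ?; rewrite big_ord0.
  exact: Dalg0.
have -> : (fun u m => \sum_(j < d.+1) T j u m) =
    (fun u m => T ord0 u m + \sum_(j < d) T (lift ord0 j) u m).
  by do 2!apply: functional_extensionality => ?; rewrite big_ord_recl.
by apply: Dalg_add; [apply: DT | apply: IHd].
Qed.

Lemma Dalg_linear alpha (T : S -> S) : Dalg alpha T ->
  forall (c : K) u w, T (fun m => c * u m + w m) = (fun m => c * T u m + T w m).
Proof.
move=> DT c; elim: DT => [|delta [delta_lin _] _|a T1 _ IH1|T1 T2 _ IH1 _ IH2|T1 T2 _ IH1 _ IH2] u w //.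
- by apply: functional_extensionality => m; apply: delta_lin.
- by apply: functional_extensionality => m; rewrite IH1 mulrDr mulrCA.
- apply: functional_extensionality => m; rewrite IH1 IH2 mulrDr addrACA //.
- by rewrite /= IH2 IH1.
Qed.

(** Strong induction on [k]: the coefficient at [k.+1] is a rational combination of earlier
    coefficients composed with the derivations [tcoef psi j]. *)
Lemma Dalg_tcoef alpha (F G : {lrmorphism A -> A}) k :
    cancel F G -> cancel G F -> raises 0 F -> raises 0 G ->
    (forall m, mord (deg m + (alpha - 1)) (F << m >> - << m >>)) ->
    (forall m m', (F << m >>)@_m'`_0 = (m == m')%:R) ->
  Dalg alpha (tcoef F k).
Proof.
move=> FK GK F0 G0 Fe Ft0.
have [psi [psiM psi_e Fpsi]] := logarithmic_derivative FK GK G0 Fe.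
have psi0 : raises 0 psi by move=> m; apply: mord_le (psi_e m); rewrite leq_add2l.
have [l] := ubnP k; elim: l k => // l IHl [_|k lt_kl].
  by rewrite tcoef0 //; apply: Dalg_one.
have natK : (k.+1%:R^-1 : rat)%:A * k.+1%:R = 1 :> K.
  have -> : k.+1%:R = (k.+1%:R : rat) *: 1 :> K by rewrite scaler_nat.
  by rewrite mulr_algl scalerA mulVf ?scale1r // Num.Theory.pnatr_eq0.
have -> : tcoef F k.+1 = fun u m => (k.+1%:R^-1 : rat)%:A *
    \sum_(j < k.+1) tcoef F (k - j) (tcoef psi j u) m.
  apply: functional_extensionality => a; apply: functional_extensionality => m.
  suff -> : \sum_(j < k.+1) tcoef F (k - j) (tcoef psi j a) m =
      tcoef F k.+1 a m *+ k.+1 by rewrite -(mulr_natl (tcoef _ _ _ _)) mulrA natK mul1r.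
  have Fpsi_coef p : (F (psi p))@_m`_k =
      (F p)@_m`_k.+1 *+ k.+1 - (F (malg_deriv p))@_m`_k.
    by rewrite Fpsi mcoeffB coefB malg_derivE coef_deriv.
  apply: etrans (esym (tcoef_comp k a m F0 psi0)) _; apply: etrans (Fpsi_coef _) _.
  (* A series over [K] is constant in [t], so the term with [malg_deriv p] vanishes. *)
  by rewrite malg_deriv_trunc linear0 mcoeff0 coef0 subr0.
apply: Dalg_scale; apply: Dalg_sum => j.
apply: (Dalg_mul (T1 := tcoef F (k - j)) (T2 := tcoef psi j)).
  by apply: IHl; rewrite (leq_ltn_trans (leq_subr _ _)).
by apply: Dalg_der; [apply: tcoef_derivation | apply: tcoef_raises_degree].
Qed.

End OperatorAlgebra.

(** * Existence and uniqueness of f(t) *)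

Section TaylorOperators.
Variables (K : comAlgType rat) (v : variables) (n alpha : nat).
Local Notation A := (polyt K v n).
Local Notation S := (series K v n).
Implicit Types (F : {lrmorphism A -> A}) (f : nat -> S -> S).

Lemma Dalg_series0 (T : S -> S) : Dalg alpha T -> T (fun=> 0) = fun=> 0.
Proof.
(* With scalar -1 and zero arguments, linearity reads [T 0 = - T 0 + T 0]. *)
move=> /Dalg_linear/(_ (-1) (fun=> 0) (fun=> 0)) T0.
have E : (fun m : mon v n => -1 * 0 + 0 : K) = fun=> 0.
  by apply: functional_extensionality => m; rewrite mulr0 addr0.
by rewrite E in T0; rewrite T0; apply: functional_extensionality => m; rewrite mulN1r addNr.
Qed.

Lemma Dalg_scaler (T : S -> S) (c : K) u : Dalg alpha T ->
  T (fun m => c * u m) = fun m => c * T u m.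
Proof.
move=> DT; have E (w : S) : (fun m => c * w m + 0) = fun m => c * w m.
  by apply: functional_extensionality => m; rewrite addr0.
by have := Dalg_linear DT c u (fun=> 0); rewrite Dalg_series0 // !E.
Qed.

(** Testing the defining identity on a series constant in [t] leaves only the term with [f k], every
    other [f j] being applied to zero. Hence [F] determines [f]. *)
Lemma is_fE F f k u m : is_f alpha F f ->
  f k u m = (-1) ^+ k * substF F (fun j => if j is 0 then u else fun=> 0) k m.
Proof.
case=> Df _ /(_ (fun j => if j is 0%N then u else fun=> 0) k m) <-.
rewrite big_ord_recr /= subnn big1 ?add0r ?signrMK // => j _.
case: (k - j)%N (subn_gt0 j k) => [|d] E; first by rewrite ltn_ord in E.
by rewrite Dalg_series0 ?mulr0.
Qed.

Lemma is_f_unique F f f' : is_f alpha F f -> is_f alpha F f' -> f = f'.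
Proof.
move=> Ff Ff'; apply: functional_extensionality => k.
apply: functional_extensionality => u; apply: functional_extensionality => m.
by rewrite (is_fE _ _ _ Ff) (is_fE _ _ _ Ff').
Qed.

(* f(t) is F with t replaced by -t, whence the sign. *)
Definition taylor F k : S -> S := fun u m => (-1) ^+ k * tcoef F k u m.

Lemma is_f_taylor F (G : {lrmorphism A -> A}) :
    cancel F G -> cancel G F -> raises 0 F -> raises 0 G ->
    (forall m, mord (deg m + (alpha - 1)) (F << m >> - << m >>)) ->
    (forall m m', (F << m >>)@_m'`_0 = (m == m')%:R) ->
  is_f alpha F (taylor F).
Proof.
move=> FK GK F0 G0 Fe Ft0; split=> [k||u j m].
- exact/Dalg_scale/(Dalg_tcoef _ FK GK).
- rewrite /taylor tcoef0 //; apply: functional_extensionality => u.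
  by apply: functional_extensionality => m; rewrite mul1r.
- by rewrite substF_tcoef; apply: eq_bigr => k _; rewrite signrMK.
Qed.

End TaylorOperators.

(** * Products of operators along words *)

Section Words.
Variables (K : comNzRingType) (v : variables) (n alpha : nat).
Local Notation S := (series K v n).
Variable f : nat -> S -> S.

Definition word_op (x : seq nat) : S -> S := foldr (fun i T => f i.+1 \o T) id x.

(** The last letter acts first, so words are processed from the right. *)
Lemma word_op_rcons x k u : word_op (rcons x k) u = word_op x (f k.+1 u).
Proof. by elim: x => //= i x ->. Qed.

Lemma Dalg_word_op x : (forall k, Dalg alpha (f k)) -> Dalg alpha (word_op x).
Proof. by move=> Df; elim: x => [|i x IHx] /=; [apply: Dalg_one | apply: Dalg_mul]. Qed.

End Words.

(** * The automorphism attached to a word *)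

Section WordAutomorphism.
Variables (K : comAlgType rat) (v : variables) (alpha : nat) (w : seq nat).
Hypothesis alpha_gt0 : (0 < alpha)%N.
Let n := (size w).+1.
Local Notation A := (polyt K v n).
Local Notation S := (series K v n).

Definition z0pow (e : nat) : mon v n := iter e (mmul (var v ord0)) mone.

(** The power of [z_0] stands on the right, which matters if the variables do not commute. [inord]
    is faithful only below [n], whence the bounds on [i] in later lemmas. *)
Definition zmon (i e : nat) : mon v n := mmul (var v (inord i)) (z0pow e).

Lemma z0powD a b : z0pow (a + b) = mmul (z0pow a) (z0pow b).
Proof. by elim: a => [|a IHa]; rewrite /= ?mul1m // -mulmA -IHa. Qed.

Lemma zmonD i a b : zmon i (a + b) = mmul (zmon i a) (z0pow b).
Proof. by rewrite /zmon z0powD mulmA. Qed.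

Lemma deg_zmon i e : deg (zmon i e) = e.+1.
Proof.
rewrite degM deg_var; congr _.+1.
by elim: e => [|e IHe]; rewrite ?deg1 //= degM deg_var IHe.
Qed.

Lemma endo_scaleM (F : {lrmorphism A -> A}) c p q :
  F (c *: (p * q)) = c *: (F p * F q).
Proof. by rewrite linearZ /= rmorphM. Qed.

Lemma endo_z0pow (F : {lrmorphism A -> A}) e :
  F << z0pow e >> = F << var v ord0 >> ^+ e.
Proof.
by elim: e => [|e IHe]; rewrite ?rmorph1 //= -malgMU rmorphM /= IHe exprS.
Qed.

(* The morphism sending [z_0] to 1 and the other variables to 0 separates the
   two monomials. *)
Lemma zmon_neq0 i e d : (0 < i < n)%N -> zmon i e != zmon 0 d.
Proof.
case/andP=> i_gt0 lt_in; apply/eqP => eq_z.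
have [F Fvar] := malg_endomorphism (fun i : 'I_n => (i == ord0)%:R : A).
have Fz0 m : F << z0pow m >> = 1 by rewrite endo_z0pow Fvar eqxx expr1n.
have Fz j m : (j < n)%N -> F << zmon j m >> = (j == 0)%:R.
  by move=> lt_jn; rewrite /zmon -malgMU rmorphM /= Fz0 mulr1 Fvar -val_eqE /= inordK.
have : F << zmon i e >> = F << zmon 0 d >> by rewrite eq_z.
rewrite !Fz //= -[i == 0%N]negbK -lt0n i_gt0 => /esym/eqP.
by rewrite oner_eq0.
Qed.

(* [H_i]; the letter [k] of [w] stands for Lambda_(k+1). *)
Definition wordH (i : nat) : A :=
  if i is i'.+1 then 'X^((nth 0%N w i').+1) *: << zmon i' (alpha - 1) >> else 0.

(* The image of [z_i] under the inverse automorphism. *)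
Fixpoint wordG (i : nat) : A := << var v (inord i) >> +
  if i is i'.+1 then 'X^((nth 0%N w i').+1) *: (wordG i' * << z0pow (alpha - 1) >>)
  else 0.

Lemma mord_wordH i : mord alpha (wordH i).
Proof.
case: i => [|i] m lt_m; first by rewrite mcoeff0.
rewrite mcoeffZ mordU ?mulr0 //.
by rewrite deg_zmon subn1 prednK.
Qed.

Lemma mord_wordG i : mord 1 (wordG i).
Proof.
elim: i => [|i IHi]; apply: (mordD (mord_var _ _)); first by move=> m _; rewrite mcoeff0.
by move=> m lt_m; rewrite mcoeffZ -[1%N]addn0 (mordM IHi (mord0 _)) ?mulr0 // addn0.
Qed.

Section Morphisms.
Variables F G : {lrmorphism A -> A}.
Hypothesis Fvar : forall i : 'I_n, F << var v i >> = << var v i >> - wordH i.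
Hypothesis Gvar : forall i : 'I_n, G << var v i >> = wordG i.

Lemma F_z0pow e : F << z0pow e >> = << z0pow e >>.
Proof.
rewrite endo_z0pow Fvar subr0.
by elim: e => [|e IHe] //=; rewrite exprS IHe malgMU.
Qed.

Lemma G_z0pow e : G << z0pow e >> = << z0pow e >>.
Proof.
rewrite endo_z0pow Gvar /= addr0 (_ : inord 0 = ord0); last first.
  by apply: val_inj; rewrite /= inordK.
by elim: e => [|e IHe] //=; rewrite exprS IHe malgMU.
Qed.

(** By induction, [F] turns the recursive summand of [wordG] into exactly the term that it subtracts
    from [z_i]. *)
Lemma F_wordG i : (i < n)%N -> F (wordG i) = << var v (inord i) >>.
Proof.
elim: i => [|i IHi] lt_in; rewrite /= ?addr0 ?rmorphD /= Fvar inordK //= ?subr0 //.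
by rewrite endo_scaleM IHi 1?ltnW // F_z0pow malgMU subrK.
Qed.

Lemma wordFK : cancel F G.
Proof.
apply: (malg_endomorphism_id (F := G \o F)) => i /=.
rewrite Fvar rmorphB /= Gvar; case: i => [[|i] lt_in] /=.
  by rewrite addr0 rmorph0 subr0; congr << var v _ >>; apply: val_inj; rewrite /= inordK.
rewrite /zmon -malgMU endo_scaleM G_z0pow Gvar inordK 1?ltnW // addrK.
by congr << var v _ >>; apply: val_inj; rewrite /= inordK.
Qed.

Lemma wordGK : cancel G F.
Proof.
apply: (malg_endomorphism_id (F := F \o G)) => i /=.
by rewrite Gvar F_wordG //; congr << var v _ >>; apply: val_inj; rewrite /= inordK.
Qed.

Lemma raises_wordF :
  raises 0 F /\ forall m, mord (deg m + (alpha - 1)) (F << m >> - << m >>).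
Proof.
apply: raises_endomorphism_sub => i; rewrite Fvar addrC addKr subn1 prednK //.
by rewrite -sub0r; apply: mordB (mord_wordH i) => m _; rewrite mcoeff0.
Qed.

Lemma raises_wordG : raises 0 G.
Proof.
apply: (proj1 (raises_endomorphism_sub (e := 0) _)) => i; rewrite Gvar.
exact: mordB (mord_wordG i) (mord_var _ _).
Qed.

Lemma wordF_coef0 m m' : (F << m >>)@_m'`_0 = (m == m')%:R.
Proof.
apply: endomorphism_coef0 => i m1.
rewrite Fvar mcoeffB coefB mcoeffU1 -polyC_natr coefC /=.
case: (i : nat) => [|i'] /=; first by rewrite mcoeff0 coef0 subr0.
by rewrite mcoeffZ coefXnM subr0.
Qed.

Lemma derivation_z0pow (d : {linear A -> A}) e :
  (forall p q, d (p * q) = d p * q + p * d q) -> d << var v ord0 >> = 0 ->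
  d << z0pow e >> = 0.
Proof.
move=> dM d0; elim: e => [|e IHe] /=; last by rewrite -malgMU dM d0 IHe mul0r mulr0 addr0.
(* The product rule gives [d 1 = d 1 + d 1], so [d 1 = 0]. *)
by have /eqP := dM 1 1; rewrite !mulr1 mul1r -subr_eq0 opprD addNKr oppr_eq0 => /eqP.
Qed.

Lemma wordF_in_B : in_B alpha F.
Proof.
have HF i : Hpart F i = wordH i by rewrite /Hpart /z_ Fvar subKr.
split.
- by exists G; [apply: wordFK | apply: wordGK].
- move=> i m; rewrite HF; case: (i : nat) => [|i'] /=; first by rewrite mcoeff0 horner0.
  by rewrite mcoeffZ hornerM hornerXn expr0n mul0r.
- exists alpha => // i m; rewrite HF -mcoeff_neq0; case: (i : nat) => [|i'] /=.
    by rewrite mcoeff0 eqxx.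
  rewrite mcoeffZ mcoeffU1; case: (zmon i' _ =P m) => [<-|_]; last by rewrite mulr0 eqxx.
  by rewrite deg_zmon subn1 prednK.
pose D j := malg_derivation (fun i : 'I_n => (i == j)%:R : A).
(* The identity permutation suffices, as [H_i] involves only [z_0] and [z_(i-1)]. *)
exists (fun i j => sval (D j) (wordH i)), 1%g; split.
  exists (fun j => sval (D j)); split=> [j|i j|i j]; last by rewrite HF.
    exact: (proj1 (svalP (D j))).
  exact: (proj2 (svalP (D j))).
move=> i j; rewrite !perm1; have [dM dvar] := svalP (D j).
move: (sval (D j)) dM dvar => d dM dvar /= le_ij.
case Di: (i : nat) => [|i'] /=; first exact: linear0.
(* Here [j >= i > 0], so [z_j] is neither [z_0] nor [z_(i-1)], and the derivation kills both factors
   of the monomial in [H_i]. *)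
have lt_i' : (i' < n)%N by rewrite ltnW // -Di.
have dz : d << z0pow (alpha - 1) >> = 0.
  apply: derivation_z0pow => //; rewrite dvar -val_eqE /=.
  by case: (j : nat) le_ij => //; rewrite Di.
rewrite linearZ /= /zmon -malgMU dM dz dvar mulr0 addr0 -val_eqE /= inordK //.
by rewrite ltn_eqF ?mul0r ?scaler0 // -Di.
Qed.

Definition mseries (m : mon v n) : S := fun m' => (m == m')%:R.

Lemma wordF_zmon i e : (i < size w)%N -> F << zmon i.+1 e >> =
  << zmon i.+1 e >> - 'X^((nth 0%N w i).+1) *: << zmon i (alpha - 1 + e) >>.
Proof.
move=> lt_iw.
have -> : << zmon i (alpha - 1 + e) >> = << zmon i (alpha - 1) >> * << z0pow e >> :> A.
  by rewrite malgMU zmonD.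
have -> : << zmon i.+1 e >> = << var v (inord i.+1) >> * << z0pow e >> :> A.
  by rewrite malgMU.
by rewrite rmorphM /= F_z0pow Fvar inordK //= mulrBl scalerAl.
Qed.

Lemma wordF_zmon0 e : F << zmon 0 e >> = << zmon 0 e >>.
Proof.
have -> : << zmon 0 e >> = << var v (inord 0) >> * << z0pow e >> :> A by rewrite malgMU.
by rewrite rmorphM /= F_z0pow Fvar inordK //= subr0.
Qed.

Lemma taylorU k m m' : taylor F k (mseries m) m' = (-1) ^+ k * (F << m >>)@_m'`_k.
Proof. by congr (_ * _); apply: tcoefU (proj1 raises_wordF). Qed.

Lemma taylor_zmon0 k e : taylor F k.+1 (mseries (zmon 0 e)) = fun=> 0.
Proof.
apply: functional_extensionality => m.
rewrite taylorU wordF_zmon0 mcoeffU1.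
by rewrite -polyC_natr coefC mulr0.
Qed.

(** The monomial [zmon i.+1 e] is constant in [t] and drops out. The minus sign before [H] and the
    sign in [taylor] at [k.+1] combine to [(-1) ^+ k]. *)
Lemma taylor_zmon k i e : (i < size w)%N ->
  taylor F k.+1 (mseries (zmon i.+1 e)) =
  fun m => (-1) ^+ k * (k == nth 0%N w i)%:R * mseries (zmon i (alpha - 1 + e)) m.
Proof.
move=> lt_iw; apply: functional_extensionality => m.
rewrite taylorU wordF_zmon // mcoeffB mcoeffZ.
rewrite !mcoeffU1 -!polyC_natr coefB coefC coefMC coefXn eqSS sub0r.
by rewrite exprS mulN1r mulrNN mulrA.
Qed.

(** Each letter, read from the right, must match the corresponding letter of [w] and then lowers [i]
    by one. A surplus letter kills [z_0 z_0^e]; a missing one leaves a monomial with [i > 0],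
    distinct from the target. The exponent [e] is general because every step adds [alpha - 1] to
    it. *)
Lemma word_op_zmon x i e : (i <= size w)%N ->
  word_op (taylor F) x (mseries (zmon i e)) (zmon 0 (i * (alpha - 1) + e)) =
  (\prod_(k <- x) (-1) ^+ k) * (x == take i w)%:R.
Proof.
have Dt : forall k, Dalg alpha (taylor F k).
  case: (is_f_taylor wordFK wordGK (proj1 raises_wordF) raises_wordG
           (proj2 raises_wordF) wordF_coef0) => //.
elim/last_ind: x i e => [|x k IHx] i e le_iw.
  rewrite big_nil mul1r /= /mseries; case: i le_iw => [|i] lt_iw.
    by rewrite mul0n eqxx take0.
  by rewrite (negbTE (zmon_neq0 _ _ _)) // eq_sym -size_eq0 size_takel.
rewrite word_op_rcons; case: i le_iw => [|i] lt_iw.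
  rewrite taylor_zmon0 (Dalg_series0 (Dalg_word_op _ Dt)) take0.
  by case: x {IHx} => [|? ?]; rewrite mulr0.
rewrite taylor_zmon // (Dalg_scaler _ _ (Dalg_word_op _ Dt)).
rewrite mulSn -addnA addnCA IHx 1?ltnW // (take_nth 0%N) // eqseq_rcons big_rcons.
by case: eqP; case: eqP; rewrite ?mulr1 ?mulr0 ?mul0r // mulrC.
Qed.

Lemma NSym_eval_word (P : NSym K) :
  P@_(FMonom w) != 0 -> NSym_eval (taylor F) P <> (fun _ _ => 0).
Proof.
(* The operator is tested on [z_r], with [r = size w], at the monomial reached after [r] matching
   letters. *)
move=> Pw /(congr1 (fun T => T (mseries (zmon (size w) 0))
                               (zmon 0 (size w * (alpha - 1) + 0)))).
rewrite /NSym_eval (bigD1_seq (FMonom w)) ?fset_uniq -?mcoeff_neq0 //=.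
rewrite -/(word_op _ _) word_op_zmon // take_size eqxx mulr1 [X in _ + X]big1 => [|x x_w].
  (* Only a sign times the coefficient of [w] survives. Signs are cancelled as involutions, since
     [K] may have zero divisors. *)
  rewrite addr0 prodrXr mulrC -[RHS](mulr0 ((-1) ^+ (\sum_(k <- w) k)%N)).
  by move=> /(can_inj (signrMK _))/eqP; apply/negP.
rewrite fmP /= in x_w.
by rewrite -/(word_op _ _) word_op_zmon // take_size (negbTE x_w) !mulr0.
Qed.

End Morphisms.
End WordAutomorphism.

Theorem theorem5p3 (K : comAlgType rat) (v : variables) (alpha : nat)
    (alpha_ge1 : (1 <= alpha)%N) (P : NSym K) (P_neq0 : P != 0) :
  exists (n : nat) (F : {lrmorphism polyt K v n -> polyt K v n})
         (f : nat -> series K v n -> series K v n),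
    [/\ (1 <= n)%N,
        in_B alpha F,
        unique (is_f alpha F) f
      & NSym_eval f P <> (fun _ _ => 0)].
Proof.
have [[w] Pw] : exists w, w \in msupp P by apply/fset0Pn; rewrite msupp_eq0.
rewrite -mcoeff_neq0 in Pw.
have [F Fvar] := malg_endomorphism
  (fun i : 'I_(size w).+1 => << var v i >> - wordH K v alpha w i).
have [G Gvar] := malg_endomorphism (fun i : 'I_(size w).+1 => wordG K v alpha w i).
have [F0 Fe] := raises_wordF alpha_ge1 Fvar.
have Ff : is_f alpha F (taylor F).
  apply: is_f_taylor (wordFK Fvar Gvar) (wordGK Fvar Gvar) F0 _ Fe (wordF_coef0 Fvar).
  exact: raises_wordG Gvar.
exists (size w).+1, F, (taylor F); split=> //.
- exact: wordF_in_B Fvar Gvar.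
- by split=> // f; apply: is_f_unique.
- exact: NSym_eval_word Fvar Gvar _ _.
Qed.
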